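(* Let $f\in L^2(\mathbb{R}^2;\mathbb{H})$ (also integrable over $\mathbb{R}^2$), and let $\mathcal{A}:\mathbb{R}^2\to\mathbb{R}^2$ be the linear map with non-singular real matrix $A=\begin{pmatrix} a & b \\ c & d \end{pmatrix}$, i.e. $\mathcal{A}(x,y)=(ax+by,\;cx+dy)$. Let $\mathcal{B}_+$ and $\mathcal{B}_-$ be the linear maps of $\mathbb{R}^2$ with matrices $$B_+=(A^{-1})^{T},\qquad B_-=\frac{1}{\det A}\begin{pmatrix} d & c \\ b & a \end{pmatrix},$$ which both have determinant $\det\mathcal{B}:=\det B_+=\det B_-=(\det A)^{-1}$. Then the quaternion Fourier transform of $\mathbf{x}\mapsto f(\mathcal{A}\mathbf{x})$ is $$\widehat{f(\mathcal{A}\mathbf{x})}(\mathbf{u})=\frac{|\det\mathcal{B}|}{2}\Big(\hat f(\mathcal{B}_+\mathbf{u})+\hat f(\mathcal{B}_-\mathbf{u})-i\,\big\{\hat f(\mathcal{B}_+\mathbf{u})-\hat f(\mathcal{B}_-\mathbf{u})\big\}\,j\Big),\qquad \mathbf{u}\in\mathbb{R}^2 .$$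
   Context: $\mathbb{H}$ is the real quaternion algebra with units $i,j,k$, $ij=-ji=k$, $jk=-kj=i$, $ki=-ik=j$, $i^2=j^2=k^2=ijk=-1$, with $|q|=\sqrt{q_r^2+q_i^2+q_j^2+q_k^2}$ for $q=q_r+q_i i+q_j j+q_k k$. $L^2(\mathbb{R}^2;\mathbb{H})$ is the set of functions $f:\mathbb{R}^2\to\mathbb{H}$ with $\int_{\mathbb{R}^2}|f(\mathbf{x})|^2\,d^2\mathbf{x}<\infty$. For $\mathbf{x}=(x,y)$ and $\mathbf{u}=(u,v)$ in $\mathbb{R}^2$, the quaternion Fourier transform (QFT) of $f$ is $$\hat f(\mathbf{u})=\int_{\mathbb{R}^2}e^{-i xu}\,f(\mathbf{x})\,e^{-j yv}\,d^2\mathbf{x},\qquad d^2\mathbf{x}=dx\,dy.$$ *)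

(* Defs.v *)
From HB Require Import structures.
From mathcomp Require Import all_boot all_order all_algebra.
From mathcomp Require Import all_classical all_reals all_analysis.
From mathcomp Require Import ring.

Set Implicit Arguments.
Unset Strict Implicit.
Unset Printing Implicit Defensive.

Import Order.TTheory GRing.Theory Num.Theory.
Import numFieldNormedType.Exports.

Local Open Scope classical_set_scope.
Local Open Scope ring_scope.

Record quat (R : Type) := Quat { qr : R; qi : R; qj : R; qk : R }.

Section QuatStructures.
Variable R : realType.
Implicit Types p q : quat R.

Definition quat_to_prod q := (qr q, qi q, qj q, qk q).

Definition quat_of_prod (t : R * R * R * R) : quat R :=
  let: (a, b, c, d) := t in Quat a b c d.

Lemma quat_to_prodK : cancel quat_to_prod quat_of_prod.
Proof. by case. Qed.

HB.instance Definition _ := Choice.copy (quat R) (can_type quat_to_prodK).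

Definition quat_zero : quat R := Quat 0 0 0 0.

Definition quat_one : quat R := Quat 1 0 0 0.

Definition quat_add p q :=
  Quat (qr p + qr q) (qi p + qi q) (qj p + qj q) (qk p + qk q).

Definition quat_opp q := Quat (- qr q) (- qi q) (- qj q) (- qk q).

Definition quat_mul p q := Quat
  (qr p * qr q - qi p * qi q - qj p * qj q - qk p * qk q)
  (qr p * qi q + qi p * qr q + qj p * qk q - qk p * qj q)
  (qr p * qj q - qi p * qk q + qj p * qr q + qk p * qi q)
  (qr p * qk q + qi p * qj q - qj p * qi q + qk p * qr q).

Definition quat_scale (t : R) q := Quat (t * qr q) (t * qi q) (t * qj q) (t * qk q).

Fact quat_addA : associative quat_add.
Proof. by move=> [????] [????] [????]; congr Quat => /=; ring. Qed.

Fact quat_addC : commutative quat_add.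
Proof. by move=> [????] [????]; congr Quat => /=; ring. Qed.

Fact quat_add0 : left_id quat_zero quat_add.
Proof. by move=> [????]; congr Quat => /=; ring. Qed.

Fact quat_addN : left_inverse quat_zero quat_opp quat_add.
Proof. by move=> [????]; congr Quat => /=; ring. Qed.

HB.instance Definition _ :=
  GRing.isZmodule.Build (quat R) quat_addA quat_addC quat_add0 quat_addN.

Fact quat_mulA : associative quat_mul.
Proof. by move=> [????] [????] [????]; congr Quat => /=; ring. Qed.

Fact quat_mul1l : left_id quat_one quat_mul.
Proof. by move=> [????]; congr Quat => /=; ring. Qed.

Fact quat_mul1r : right_id quat_one quat_mul.
Proof. by move=> [????]; congr Quat => /=; ring. Qed.

Fact quat_mulDl : left_distributive quat_mul +%R.
Proof. by move=> [????] [????] [????]; congr Quat => /=; ring. Qed.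

Fact quat_mulDr : right_distributive quat_mul +%R.
Proof. by move=> [????] [????] [????]; congr Quat => /=; ring. Qed.

Fact quat_one_neq0 : quat_one != 0.
Proof. by apply/eqP => -[] /eqP; rewrite oner_eq0. Qed.

HB.instance Definition _ := GRing.Zmodule_isNzRing.Build (quat R)
  quat_mulA quat_mul1l quat_mul1r quat_mulDl quat_mulDr quat_one_neq0.

Fact quat_scaleA a b q : quat_scale a (quat_scale b q) = quat_scale (a * b) q.
Proof. by case: q => ????; congr Quat => /=; ring. Qed.

Fact quat_scale1 : left_id 1 quat_scale.
Proof. by move=> [????]; congr Quat => /=; ring. Qed.

Fact quat_scaleDr : right_distributive quat_scale +%R.
Proof. by move=> ? [????] [????]; congr Quat => /=; ring. Qed.

Fact quat_scaleDl q : {morph quat_scale^~ q : a b / a + b}.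
Proof. by move=> ??; case: q => ????; congr Quat => /=; ring. Qed.

HB.instance Definition _ := GRing.Zmodule_isLmodule.Build R (quat R)
  quat_scaleA quat_scale1 quat_scaleDr quat_scaleDl.

End QuatStructures.

Section Quaternions.
Variable R : realType.
Implicit Types q : quat R.

Definition quat_i : quat R := Quat 0 1 0 0.

Definition quat_j : quat R := Quat 0 0 1 0.

Definition quat_k : quat R := Quat 0 0 0 1.

Lemma quat_ij : quat_i * quat_j = quat_k /\ quat_j * quat_i = - quat_k.
Proof. by split; congr Quat => /=; ring. Qed.

Lemma quat_jk : quat_j * quat_k = quat_i /\ quat_k * quat_j = - quat_i.
Proof. by split; congr Quat => /=; ring. Qed.

Lemma quat_ki : quat_k * quat_i = quat_j /\ quat_i * quat_k = - quat_j.
Proof. by split; congr Quat => /=; ring. Qed.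

Lemma quat_sqr : [/\ quat_i ^+ 2 = -1, quat_j ^+ 2 = -1, quat_k ^+ 2 = -1
  & quat_i * quat_j * quat_k = -1].
Proof. by split; congr Quat => /=; ring. Qed.

Definition qnorm q : R :=
  Num.sqrt (qr q ^+ 2 + qi q ^+ 2 + qj q ^+ 2 + qk q ^+ 2).

(* The exponential series; its limit is taken coordinatewise. *)
Definition qexp q : quat R :=
  let S := series (fun n => n`!%:R^-1 *: q ^+ n) in
  Quat (limn (@qr R \o S)) (limn (@qi R \o S))
       (limn (@qj R \o S)) (limn (@qk R \o S)).

Lemma expr_scale_sqrN1 q (t : R) n : q ^+ 2 = -1 ->
  n`!%:R^-1 *: (t *: q) ^+ n = cos_coeff t n *: (1 : quat R) + sin_coeff t n *: q.
Proof.
move=> q2.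
have sE (a b : R) (p p' : quat R) :
      (a *: p) * (b *: p') = (a * b) *: (p * p').
  by case: p => ????; case: p' => ????; congr Quat => /=; ring.
have -> : (t *: q) ^+ n = t ^+ n *: q ^+ n.
  by elim: n => [|n IH]; rewrite ?expr0 ?scale1r// !exprS IH sE.
have -> : q ^+ n = (-1) ^+ n./2 *: q ^+ odd n.
  rewrite -[in LHS](odd_double_half n) exprD -muln2 mulnC exprM q2.
  elim: (n./2) => [|m IH]; first by rewrite !expr0 mulr1 scale1r.
  by rewrite exprS mulN1r mulrN IH exprS mulN1r scaleNr.
rewrite /cos_coeff /sin_coeff /=; case: (boolP (odd n)) => on /=.
- have -> : n.-1./2 = n./2 by rewrite -[n in LHS](odd_double_half n) on doubleK.
  by rewrite [q ^+ _]expr1 !mul0r scale0r add0r !scalerA; congr (_ *: _); ring.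
- rewrite [q ^+ _]expr0 !mul0r scale0r addr0 -exprnP !scalerA.
  by congr (_ *: _); ring.
Qed.

Lemma qexp_cos_sin q (t : R) : q ^+ 2 = -1 ->
  qexp (t *: q) = cos t *: (1 : quat R) + sin t *: q.
Proof.
move=> q2; rewrite /qexp.
have -> : series (fun n => n`!%:R^-1 *: (t *: q) ^+ n) = (fun n =>
    series (cos_coeff t) n *: (1 : quat R) + series (sin_coeff t) n *: q).
  apply/funext => n; rewrite /series /= !scaler_suml -big_split /=.
  by apply: eq_bigr => m _; exact: expr_scale_sqrN1.
have L (a b : R) : (fun n : nat => series (cos_coeff t) n * a +
    series (sin_coeff t) n * b) @ \oo --> cos t * a + sin t * b.
  have cc : series (cos_coeff t) @ \oo --> cos t.
    by rewrite cos.unlock; exact: is_cvg_series_cos_coeff.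
  have cs : series (sin_coeff t) @ \oo --> sin t.
    by rewrite sin.unlock; exact: is_cvg_series_sin_coeff.
  by apply: cvgD; exact: cvgMr_tmp.
by congr Quat; apply/cvg_lim => //; exact: L.
Qed.

End Quaternions.

Arguments quat_i {R}.
Arguments quat_j {R}.
Arguments quat_k {R}.

(* Lebesgue measure on the plane: the completion of the product of the Borel
   Lebesgue measures, so that its measurable sets are the Lebesgue-measurable
   ones (cf. completed_lebesgue_measure on the line). *)
Definition plane (R : realType) :=
  caratheodory_type ((@lebesgue_measure R \x @lebesgue_measure R)%E^*)%mu.

HB.instance Definition _ (R : realType) := Measurable.on (plane R).

Definition plane_measure (R : realType) : set (plane R) -> \bar R :=
  @completed_measure_extension _ _ _ (@lebesgue_measure R \x @lebesgue_measure R)%E.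

HB.instance Definition _ (R : realType) := Measure.on (@plane_measure R).

Section PlaneFunctions.
Variable R : realType.

Local Notation mu := (@plane_measure R).

Implicit Types (f : R * R -> quat R) (u : R * R).

Definition quat_measurable f :=
  [/\ measurable_fun [set: plane R] (@qr R \o f),
      measurable_fun [set: plane R] (@qi R \o f),
      measurable_fun [set: plane R] (@qj R \o f) &
      measurable_fun [set: plane R] (@qk R \o f)].

Definition quat_L2 f :=
  quat_measurable f /\ (\int[mu]_x (qnorm (f x) ^+ 2)%:E < +oo)%E.

Definition quat_integrable f :=
  quat_measurable f /\ (\int[mu]_x (qnorm (f x))%:E < +oo)%E.

Definition quat_integral f : quat R :=
  Quat (\int[mu]_x qr (f x)) (\int[mu]_x qi (f x))
       (\int[mu]_x qj (f x)) (\int[mu]_x qk (f x)).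

Definition qft f u : quat R :=
  quat_integral (fun x => qexp (- (x.1 * u.1) *: quat_i) * f x *
                          qexp (- (x.2 * u.2) *: quat_j)).

Definition mx2 (a b c d : R) : 'M[R]_2 :=
  \matrix_(s, t) if s == 0 then (if t == 0 then a else b)
                 else (if t == 0 then c else d).

(* The action of a matrix on column vectors (x, y)^T. *)
Definition mx_plane (M : 'M[R]_2) (x : R * R) : R * R :=
  (M 0 0 * x.1 + M 0 1 * x.2, M 1 0 * x.1 + M 1 1 * x.2).

End PlaneFunctions.

(* Main.v *)
Require Import Defs.
From HB Require Import structures.
From mathcomp Require Import all_boot all_order all_algebra.
From mathcomp Require Import all_classical all_reals all_analysis.
From mathcomp Require Import measurable_realfun ring lra.

Import Order.TTheory GRing.Theory Num.Theory.
Import numFieldNormedType.Exports.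

(* Substituting y = A x turns the transform of f o A into |det A|^-1 times the
   integral of e^(-i s(y)) f(y) e^(-j t(y)), where s and t are linear forms that
   both depend on the two coordinates of y.  Left multiplication by e^(-i s)
   acts on q - i q j as right multiplication by e^(-j s), and on q + i q j as
   right multiplication by e^(j s); hence on these two parts the kernel only
   depends on s + t, respectively s - t.  B_+ is the matrix for which the
   separated kernel e^(-i y1 u1') f e^(-j y2 u2') has the same sum of phases,
   and B_- the one for which it has the same difference of phases.
   The change of variables for the completed product measure is obtained on
   Borel sets by factoring A into shears and swaps, and passes to the outer
   measure because A maps covers to covers. *)

Local Open Scope classical_set_scope.
Local Open Scope ring_scope.

(** * Scaling of planar Lebesgue measure under linear maps, for Borel sets and for the outer
    measure *)

Section BorelScaling.
Variable R : realType.
Local Notation bR := (measurableTypeR R).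
Local Notation lam := (@lebesgue_measure R).
Local Notation lam2 := (lam \x lam)%E.

Lemma measurable_affine (c d : R) :
  measurable_fun setT ((fun y => c + d * y) : bR -> bR).
Proof. by apply: measurable_funD => //; exact: measurable_funM. Qed.

(** By uniqueness of Lebesgue measure: the pushforward along the affine map, rescaled by [|d|],
    gives half-open intervals their length. *)
Lemma lebesgue_measure_affine (c d : R) (E : set bR) :
  d != 0 -> measurable E ->
  lam ((fun y => c + d * y) @^-1` E) = (`|d|^-1%:E * lam E)%E.
Proof.
move=> d0 mE.
pose m := mscale (NngNum (normr_ge0 d))
  (measure_function_pushforward__canonical__measure_function_Measure
     lam (measurable_affine c d)).
have mdef A : m A = (`|d|%:E * lam ((fun y => (c + d * y)%R) @^-1` A))%E by [].
have -> : lam E = m E.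
  apply: lebesgue_measure_unique => // _ [[p q] _ <-].
  apply: etrans (esym (mdef _)); rewrite lebesgue_measure_itv /= lte_fin.
  have /orP[d_gt0|d_lt0] : (0 < d) || (d < 0) by rewrite orbC -neq_lt.
  - rewrite [X in lam X](_ : _ = `](p - c) / d, (q - c) / d]%classic); last first.
      by apply/seteqP; split=> y /=;
        rewrite !in_itv/= ltr_pdivrMr// ler_pdivlMr// ltrBlDl lerBrDl (mulrC y).
    rewrite lebesgue_measure_itv /= lte_fin ltr_pM2r ?invr_gt0// ltrD2r gtr0_norm//.
    case: ifP => _; rewrite ?mule0// -!EFinB -EFinM; congr EFin; field.
    by rewrite gt_eqF.
  (* A negative slope reverses the interval, so the closed end moves to the left. *)
  - rewrite [X in lam X](_ : _ = `[(q - c) / d, (p - c) / d[%classic); last first.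
      by apply/seteqP; split=> y /=;
        rewrite !in_itv/= ltr_ndivlMr// ler_ndivrMr// ltrBlDl lerBrDl (mulrC y) andbC.
    rewrite lebesgue_measure_itv /= lte_fin ltr_nM2r ?invr_lt0// ltrD2r ltr0_norm//.
    case: ifP => _; rewrite ?mule0// -!EFinB -EFinM; congr EFin; field.
    by rewrite lt_eqF.
by rewrite mdef muleA -EFinM mulVf ?normr_eq0// mul1e.
Qed.

(** The factor is that of preimages, so a linear map has the inverse of its absolute determinant as
    [k]. *)
Definition borel_scaling (phi : R * R -> R * R) (k : R) :=
  measurable_fun [set: bR * bR] (phi : bR * bR -> bR * bR) /\
  forall E : set (bR * bR), measurable E -> lam2 (phi @^-1` E) = (k%:E * lam2 E)%E.

Lemma borel_scaling_comp phi psi k l :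
  borel_scaling phi k -> borel_scaling psi l ->
  borel_scaling (phi \o psi) (k * l).
Proof.
move=> [mphi kphi] [mpsi kpsi]; split; first exact: measurableT_comp.
move=> E mE; rewrite comp_preimage kpsi; last first.
  by move: (mphi measurableT _ mE); rewrite setTI.
by rewrite kphi// EFinM muleA (muleC l%:E).
Qed.

Lemma borel_scaling_swap : borel_scaling (@swap_pair R R) 1.
Proof.
have mswap : measurable_fun [set: bR * bR] (swap_pair : bR * bR -> bR * bR).
  by apply: measurable_fun_pair; [exact: measurable_snd|exact: measurable_fst].
split=> // E mE; rewrite mul1e.
pose m := measure_function_pushforward__canonical__measure_function_Measure lam2 mswap.
apply/esym; rewrite -[RHS]/(m E); apply: product_measure_unique => // A B mA mB.
rewrite /m/= /pushforward.
have -> : swap_pair @^-1` (A `*` B) = B `*` A.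
  by apply/seteqP; split => -[x y] [].
by rewrite [LHS]product_measure1E// muleC.
Qed.

(** The section at [x] of the preimage is the preimage of the section under [y |-> c * x + d * y],
    so the one-dimensional scaling integrates over [x]. *)
Lemma borel_scaling_shear (c d : R) : d != 0 ->
  borel_scaling (fun x => (x.1, c * x.1 + d * x.2)) `|d|^-1.
Proof.
move=> d0; split.
  apply: measurable_fun_pair => //; apply: measurable_funD.
    by apply: measurable_funM => //; exact: measurable_fst.
  by apply: measurable_funM => //; exact: measurable_snd.
move=> E mE; rewrite /product_measure1.
under eq_integral => x _.
  rewrite /=.
  have -> : xsection ((fun x0 : bR * bR => (x0.1, c * x0.1 + d * x0.2)) @^-1` E) x =
    (fun y => c * x + d * y) @^-1` xsection E x.
    by apply/seteqP; split => y; rewrite /xsection/= !inE.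
  rewrite lebesgue_measure_affine//; last exact: measurable_xsection.
  over.
rewrite ge0_integralZl//.
exact: measurable_fun_xsection.
Qed.

Lemma borel_scaling_linear (a b c d : R) : a * d - b * c != 0 ->
  borel_scaling (fun x => (a * x.1 + b * x.2, c * x.1 + d * x.2))
    `|a * d - b * c|^-1.
Proof.
have nonzero_d (p q r s : R) : s != 0 -> p * s - q * r != 0 ->
    borel_scaling (fun x => (p * x.1 + q * x.2, r * x.1 + s * x.2))
      `|p * s - q * r|^-1.
  move=> s0 det0.
  pose sh (u v : R) (x : R * R) := (x.1, u * x.1 + v * x.2).
  (* The first shear and swap produce [(r x1 + s x2, x1)]; then [p x1 + q x2] is [q / s] times the
     first entry plus [det / s] times the second. *)
  have -> : (fun x : R * R => (p * x.1 + q * x.2, r * x.1 + s * x.2)) =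
      (@swap_pair R R \o sh (q / s) ((p * s - q * r) / s)) \o (@swap_pair R R \o sh r s).
    apply/funext => x; rewrite /sh /swap_pair /=; congr pair; field.
    exact: s0.
  have -> : `|p * s - q * r|^-1 = (1 * `|(p * s - q * r) / s|^-1) * (1 * `|s|^-1).
    by rewrite !mul1r -invfM -normrM divfK.
  have qs0 : (p * s - q * r) / s != 0 by rewrite mulf_neq0 ?invr_eq0.
  apply: borel_scaling_comp; apply: borel_scaling_comp;
    solve [exact: borel_scaling_swap | exact: borel_scaling_shear].
(* If [d = 0] then [c] is nonzero, and a swap exchanging the columns reduces to the previous case;
   the determinant only changes sign. *)
move=> det0; have [d0|] := eqVneq d 0; last by move/nonzero_d; exact.
have c0 : c != 0.
  by apply: contraNneq det0 => ->; rewrite d0 !mulr0 subrr.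
have -> : (fun x : R * R => (a * x.1 + b * x.2, c * x.1 + d * x.2)) =
    (fun x : R * R => (b * x.1 + a * x.2, d * x.1 + c * x.2)) \o @swap_pair R R.
  by apply/funext => x; rewrite /swap_pair /= addrC (addrC (d * _)).
have -> : `|a * d - b * c|^-1 = `|b * c - a * d|^-1 * 1 by rewrite mulr1 distrC.
apply: borel_scaling_comp borel_scaling_swap; apply: nonzero_d => //.
by rewrite -oppr_eq0 opprB.
Qed.

Lemma mu_ext_scaling_le phi k (E : set (R * R)) : 0 < k -> borel_scaling phi k ->
  ((lam2^*)%mu (phi @^-1` E) <= k%:E * (lam2^*)%mu E)%E.
Proof.
move=> k0 [mphi kphi]; rewrite -lee_pdivrMl//.
apply: le_ereal_inf_tmp => _ [F [mF EF] <-].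
rewrite lee_pdivrMl// -nneseriesZl//.
apply: ereal_inf_lbound; exists (fun i => phi @^-1` F i).
  split=> [i|]; first by move: (mphi measurableT _ (mF i)); rewrite setTI.
  by rewrite -preimage_bigcup; exact: preimage_subset.
by apply: eq_eseriesr => i _; rewrite kphi.
Qed.

Lemma mu_ext_scaling phi psi k (E : set (R * R)) : 0 < k -> cancel psi phi ->
  borel_scaling phi k -> borel_scaling psi k^-1 ->
  ((lam2^*)%mu (phi @^-1` E) = k%:E * (lam2^*)%mu E)%E.
Proof.
move=> k0 psiK hphi hpsi; apply/eqP; rewrite eq_le mu_ext_scaling_le//=.
rewrite -lee_pdivlMl//.
have {1}-> : E = psi @^-1` (phi @^-1` E).
  by apply/seteqP; split => x /=; rewrite psiK.
by rewrite mu_ext_scaling_le ?invr_gt0.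
Qed.

End BorelScaling.

(** * Linear change of variables for the completed planar measure *)

Section Plane.
Variable R : realType.
Local Notation bR := (measurableTypeR R).
Local Notation lam := (@lebesgue_measure R).
Local Notation lam2 := (lam \x lam)%E.
Local Notation mu := (@plane_measure R).

(** Holds by unfolding: the sigma-algebra of [plane] is the Caratheodory one, and [mu] is the outer
    measure itself. *)
Lemma measurable_planeP (E : set (plane R)) : measurable E <->
  forall X, (mu X = mu (X `&` E) + mu (X `&` ~` E))%E.
Proof. by []. Qed.

Definition mx_plane_inv (a b c d : R) (x : R * R) : R * R :=
  let D := a * d - b * c in
  (d / D * x.1 + - b / D * x.2, - c / D * x.1 + a / D * x.2).

Section ChangeOfVariables.
Variables a b c d : R.
Let D := a * d - b * c.
Hypothesis D0 : D != 0.

Let phi (x : R * R) : R * R := (a * x.1 + b * x.2, c * x.1 + d * x.2).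
Let psi := mx_plane_inv a b c d.

Let psiK : cancel psi phi.
Proof.
by move=> [x y]; rewrite /phi /psi /mx_plane_inv /=; congr pair; field.
Qed.

Let phiK : cancel phi psi.
Proof.
by move=> [x y]; rewrite /phi /psi /mx_plane_inv /=; congr pair; field.
Qed.

Lemma plane_measure_linear (E : set (R * R)) :
  mu (phi @^-1` E) = (`|D|^-1%:E * mu E)%E.
Proof.
apply: (@mu_ext_scaling _ _ psi) => //; first by rewrite invr_gt0 normr_gt0.
  exact: borel_scaling_linear.
(* [psi] has determinant [D^-1], which gives it the reciprocal scaling factor. *)
have detE : d / D * (a / D) - - b / D * (- c / D) = D^-1.
  by rewrite /D; field; exact: D0.
rewrite -normfV -detE; apply: borel_scaling_linear; rewrite detE.
by rewrite invr_eq0.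
Qed.

(* The scaling holds for all sets, measurable or not, so the Caratheodory
   criterion is transported along the bijection. *)
Lemma measurable_plane_linear : measurable_fun [set: plane R] (phi : plane R -> plane R).
Proof.
move=> _ E /measurable_planeP mE; rewrite setTI; apply/measurable_planeP => X.
pose Y := psi @^-1` X.
have -> : X = phi @^-1` Y by apply/seteqP; split=> x /=; rewrite /Y /= phiK.
rewrite preimage_setC -!preimage_setI !plane_measure_linear.
by rewrite -ge0_muleDr// -mE.
Qed.

(** The left side integrates [f] against the pushforward of [mu], which is [mu] rescaled by
    [|D|^-1]. *)
Lemma ge0_integral_plane_linear (f : plane R -> \bar R) :
  measurable_fun setT f -> (forall x, 0 <= f x)%E ->
  (\int[mu]_x f (phi x) = `|D|^-1%:E * \int[mu]_x f x)%E.
Proof.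
move=> mf f0; have k0 : 0 <= `|D|^-1 by rewrite invr_ge0.
rewrite -[RHS](@ge0_integral_mscale _ _ _ mu setT _ (NngNum k0))//.
rewrite -(@ge0_integral_pushforward _ _ _ _ _ _ measurable_plane_linear mu setT)//.
apply: eq_measure_integral => [|mphi A mA _]; first exact: measurable_plane_linear.
exact: plane_measure_linear.
Qed.

Lemma Rintegral_plane_linear (g : plane R -> R) :
  mu.-integrable setT (EFin \o g) ->
  \int[mu]_x g (phi x) = `|D|^-1 * \int[mu]_x g x.
Proof.
move=> ig; have mg := measurable_int mu ig.
rewrite -RintegralZl// /Rintegral; congr fine.
under [RHS]eq_integral do rewrite EFinM.
rewrite integralZl// [LHS]integralE [X in (_ * X)%E]integralE.
(* Finiteness of both parts lets the factor distribute over their difference. *)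
have fp := integrable_pos_fin_num measurableT ig.
have fn := integrable_neg_fin_num measurableT ig.
rewrite muleBr//; last by rewrite fin_num_adde_defl// fin_numN.
have Ep := ge0_integral_plane_linear (EFin \o g)^\+%E
  (measurable_funepos mg) (funepos_ge0 _).
have En := ge0_integral_plane_linear (EFin \o g)^\-%E
  (measurable_funeneg mg) (funeneg_ge0 _).
congr (_ - _)%E; [apply: etrans Ep|apply: etrans En]; apply: eq_integral => x _.
  by rewrite !funepos.unlock.
by rewrite !funeneg.unlock.
Qed.

End ChangeOfVariables.

(** The Caratheodory sigma-algebra contains the Borel product one. *)
Lemma measurable_plane_borel (g : bR * bR -> bR) : measurable_fun setT g ->
  measurable_fun [set: plane R] (g : plane R -> R).
Proof.
move=> mg _ E mE; rewrite setTI; apply: sub_caratheodory.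
apply: sub_sigma_algebra.
by move: (mg measurableT _ mE); rewrite setTI.
Qed.

Lemma measurable_plane_comp_linear (h : R -> R) (p q : R) : continuous h ->
  measurable_fun [set: plane R] (fun x : R * R => h (p * x.1 + q * x.2)).
Proof.
move=> ch; apply: measurable_plane_borel.
apply: (measurableT_comp (f := h)).
  exact: continuous_measurable_fun.
apply: measurable_funD.
  by apply: measurable_funM => //; exact: measurable_fst.
by apply: measurable_funM => //; exact: measurable_snd.
Qed.

End Plane.

(** * Algebra of the two-sided quaternion kernel *)

Section QuaternionKernel.
Variable R : realType.
Implicit Types (q : quat R) (f : R * R -> quat R).

Lemma qexp_i (t : R) : qexp (t *: quat_i) = Quat (cos t) (sin t) 0 0.
Proof.
rewrite qexp_cos_sin; last by case: (quat_sqr R).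
by congr Quat => /=; ring.
Qed.

Lemma qexp_j (t : R) : qexp (t *: quat_j) = Quat (cos t) 0 (sin t) 0.
Proof.
rewrite qexp_cos_sin; last by case: (quat_sqr R).
by congr Quat => /=; ring.
Qed.

Lemma qnormM p q : qnorm (p * q) = qnorm p * qnorm q.
Proof.
rewrite /qnorm -sqrtrM; last by rewrite !addr_ge0// sqr_ge0.
by congr Num.sqrt; case: p => ????; case: q => ???? /=; ring.
Qed.

Lemma qnorm_qexp_i (t : R) : qnorm (qexp (t *: quat_i)) = 1.
Proof.
by rewrite qexp_i /qnorm /= expr0n/= !addr0 cos2Dsin2 sqrtr1.
Qed.

Lemma qnorm_qexp_j (t : R) : qnorm (qexp (t *: quat_j)) = 1.
Proof.
by rewrite qexp_j /qnorm /= expr0n/= !addr0 cos2Dsin2 sqrtr1.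
Qed.

Lemma quat_iMj q : quat_i * q * quat_j = Quat (qk q) (- qj q) (- qi q) (qr q).
Proof. by case: q => ????; congr Quat => /=; ring. Qed.

(** The transform kernel with free phases, so that it also covers the integrand after substitution,
    where each phase depends on both coordinates. *)
Definition sandwich q (s t : R) :=
  qexp (s *: quat_i) * q * qexp (t *: quat_j).

Lemma qnorm_sandwich q s t : qnorm (sandwich q s t) = qnorm q.
Proof. by rewrite !qnormM qnorm_qexp_i qnorm_qexp_j mul1r mulr1. Qed.

Lemma sandwichE q s t : sandwich q s t = Quat
    (cos s * cos t * qr q - sin s * cos t * qi q - cos s * sin t * qj q + sin s * sin t * qk q)
    (cos s * cos t * qi q + sin s * cos t * qr q - cos s * sin t * qk q - sin s * sin t * qj q)
    (cos s * cos t * qj q - sin s * cos t * qk q + cos s * sin t * qr q - sin s * sin t * qi q)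
    (cos s * cos t * qk q + sin s * cos t * qj q + cos s * sin t * qi q + sin s * sin t * qr q).
Proof. by rewrite /sandwich qexp_i qexp_j; case: q => ????; congr Quat => /=; ring. Qed.

(* The products of a cosine or sine of s with one of t are determined by the
   cosines and sines of s + t and s - t. *)
Lemma sandwich_split q (s t s1 t1 s2 t2 : R) :
  s1 + t1 = s + t -> s2 - t2 = s - t ->
  sandwich q s t + sandwich q s t = sandwich q s1 t1 + sandwich q s2 t2
    - quat_i * (sandwich q s1 t1 - sandwich q s2 t2) * quat_j.
Proof.
move=> h1 h2; rewrite !sandwichE quat_iMj.
have := cosD s1 t1; have := sinD s1 t1; rewrite h1 cosD sinD.
have := cosB s2 t2; have := sinB s2 t2; rewrite h2 cosB sinB.
(* With the products generalized, the addition formulas become four linear relations, and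
   eliminating one variable from each leaves a ring identity. *)
move: (cos s * cos t) (sin s * sin t) (sin s * cos t) (cos s * sin t) => x1 x2 x3 x4.
move: (cos s1 * cos t1) (sin s1 * sin t1) (sin s1 * cos t1) (cos s1 * sin t1) => y1 y2 y3 y4.
move: (cos s2 * cos t2) (sin s2 * sin t2) (sin s2 * cos t2) (cos s2 * sin t2) => z1 z2 z3 z4.
move=> /(canRL (subrK _)) e1 /(canRL (addrK _)) e2 /(canRL (addrK _)) e3 /(canRL (subrK _)) e4.
have {}e1 : z3 = x3 - x4 + z4 by rewrite e1; ring.
have {}e2 : z1 = x1 + x2 - z2 by rewrite e2; ring.
have {}e3 : y3 = x3 + x4 - y4 by rewrite e3; ring.
have {}e4 : y1 = x1 - x2 + y2 by rewrite e4; ring.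
by rewrite e1 e2 e3 e4; congr Quat => /=; ring.
Qed.

End QuaternionKernel.

Arguments sandwich {R} q s t.

(** * Integrability and coordinatewise integration of quaternion-valued functions *)

Section QuaternionIntegral.
Variable R : realType.
Local Notation mu := (@plane_measure R).
Implicit Types F G : R * R -> quat R.

Lemma quat_measurableM F G : quat_measurable F -> quat_measurable G ->
  quat_measurable (fun x => F x * G x).
Proof.
move=> [Fr Fi Fj Fk] [Gr Gi Gj Gk].
split.
- exact: (measurable_funB (measurable_funB (measurable_funB
    (measurable_funM Fr Gr) (measurable_funM Fi Gi))
    (measurable_funM Fj Gj)) (measurable_funM Fk Gk)).
- exact: (measurable_funB (measurable_funD (measurable_funD
    (measurable_funM Fr Gi) (measurable_funM Fi Gr))
    (measurable_funM Fj Gk)) (measurable_funM Fk Gj)).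
- exact: (measurable_funD (measurable_funD (measurable_funB
    (measurable_funM Fr Gj) (measurable_funM Fi Gk))
    (measurable_funM Fj Gr)) (measurable_funM Fk Gi)).
- exact: (measurable_funD (measurable_funB (measurable_funD
    (measurable_funM Fr Gk) (measurable_funM Fi Gj))
    (measurable_funM Fj Gi)) (measurable_funM Fk Gr)).
Qed.

Lemma quat_measurable_qexp_i (p q : R) :
  quat_measurable (fun x => qexp ((p * x.1 + q * x.2) *: quat_i)).
Proof.
under eq_fun do rewrite qexp_i.
split; [| |exact: measurable_cst|exact: measurable_cst].
- by apply: measurable_plane_comp_linear; exact: continuous_cos.
- by apply: measurable_plane_comp_linear; exact: continuous_sin.
Qed.

Lemma quat_measurable_qexp_j (p q : R) :
  quat_measurable (fun x => qexp ((p * x.1 + q * x.2) *: quat_j)).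
Proof.
under eq_fun do rewrite qexp_j.
split; [|exact: measurable_cst| |exact: measurable_cst].
- by apply: measurable_plane_comp_linear; exact: continuous_cos.
- by apply: measurable_plane_comp_linear; exact: continuous_sin.
Qed.

(** The exponentials have norm 1, so the norm of the integrand is unchanged and only measurability
    needs work. *)
Lemma quat_integrable_sandwich F (p q r s : R) : quat_integrable F ->
  quat_integrable (fun x =>
    sandwich (F x) (p * x.1 + q * x.2) (r * x.1 + s * x.2)).
Proof.
move=> [mF iF]; split.
  exact: (quat_measurableM _ _ (quat_measurableM _ _
    (quat_measurable_qexp_i p q) mF) (quat_measurable_qexp_j r s)).
by under eq_integral do rewrite qnorm_sandwich.
Qed.

Lemma quat_integrable_qft F (u : R * R) : quat_integrable F ->
  quat_integrable (fun x => sandwich (F x) (- (x.1 * u.1)) (- (x.2 * u.2))).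
Proof.
move=> /(quat_integrable_sandwich _ (- u.1) 0 0 (- u.2)).
suff -> : (fun x => sandwich (F x) (- u.1 * x.1 + 0 * x.2) (0 * x.1 + - u.2 * x.2))
  = (fun x => sandwich (F x) (- (x.1 * u.1)) (- (x.2 * u.2))) by [].
by apply/funext => x; rewrite !mul0r add0r addr0 !mulNr ![u.1 * _]mulrC ![u.2 * _]mulrC.
Qed.

(** Each coordinate is dominated by the norm. *)
Lemma quat_integrable_coord F : quat_integrable F ->
  [/\ mu.-integrable setT (EFin \o (@qr R \o F)),
      mu.-integrable setT (EFin \o (@qi R \o F)),
      mu.-integrable setT (EFin \o (@qj R \o F)) &
      mu.-integrable setT (EFin \o (@qk R \o F))].
Proof.
move=> [[Fr Fi Fj Fk] iF].
have mN : measurable_fun [set: plane R] (fun x => (qnorm (F x))%:E).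
  apply/measurable_EFinP.
  have mS := measurable_funD (measurable_funD (measurable_funD
      (measurable_funX 2 Fr) (measurable_funX 2 Fi))
      (measurable_funX 2 Fj)) (measurable_funX 2 Fk).
  have := measurableT_comp (continuous_measurable_fun (@sqrt_continuous R)) mS.
  exact.
have bounded (h : R * R -> R) : measurable_fun [set: plane R] h ->
    (forall x, h x ^+ 2 <= qr (F x) ^+ 2 + qi (F x) ^+ 2 + qj (F x) ^+ 2 + qk (F x) ^+ 2) ->
    mu.-integrable setT (EFin \o h).
  move=> mh hF; apply/integrableP; split; first exact/measurable_EFinP.
  have mEh : measurable_fun [set: plane R] (EFin \o h) by exact/measurable_EFinP.
  have mabs := measurableT_comp (@abse_measurable R setT) mEh.
  apply: le_lt_trans iF; apply: ge0_le_integral.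
  - exact: measurableT.
  - by move=> x _; exact: abse_ge0.
  - exact: mabs.
  - exact: mN.
  - by move=> x _; rewrite /= lee_fin -sqrtr_sqr ler_wsqrtr.
by split; apply: bounded => // x /=; rewrite -subr_ge0;
  have := sqr_ge0 (qr (F x)); have := sqr_ge0 (qi (F x));
  have := sqr_ge0 (qj (F x)); have := sqr_ge0 (qk (F x)); lra.
Qed.

(** One real coordinate of [quat_integral_split]; [h3] and [h4] come from the coordinate that
    [q |-> i q j] moves into place. *)
Lemma Rintegral_double_eq (g h1 h2 h3 h4 : R * R -> R) :
  mu.-integrable setT (EFin \o g) ->
  mu.-integrable setT (EFin \o h1) -> mu.-integrable setT (EFin \o h2) ->
  mu.-integrable setT (EFin \o h3) -> mu.-integrable setT (EFin \o h4) ->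
  (forall x, g x + g x = h1 x + h2 x - (h3 x - h4 x)) ->
  \int[mu]_x g x + \int[mu]_x g x = \int[mu]_x h1 x + \int[mu]_x h2 x
    - (\int[mu]_x h3 x - \int[mu]_x h4 x).
Proof.
move=> ig i1 i2 i3 i4 gE.
have i12 : mu.-integrable setT (EFin \o (fun x => h1 x + h2 x)).
  by rewrite (_ : _ \o _ = (EFin \o h1) \+ (EFin \o h2))%E//; exact: integrableD.
have i34 : mu.-integrable setT (EFin \o (fun x => h3 x - h4 x)).
  by rewrite (_ : _ \o _ = (EFin \o h3) \- (EFin \o h4))%E//; exact: integrableB.
rewrite -(RintegralD measurableT ig ig) -(RintegralD measurableT i1 i2).
rewrite -(RintegralB measurableT i3 i4) -(RintegralB measurableT i12 i34).
by apply: eq_Rintegral => x _; exact: gE.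
Qed.

Lemma quat_integral_split G H1 H2 :
  quat_integrable G -> quat_integrable H1 -> quat_integrable H2 ->
  (forall x, G x + G x = H1 x + H2 x - quat_i * (H1 x - H2 x) * quat_j) ->
  quat_integral G + quat_integral G = quat_integral H1 + quat_integral H2
    - quat_i * (quat_integral H1 - quat_integral H2) * quat_j.
Proof.
move=> /quat_integrable_coord[Gr Gi Gj Gk] /quat_integrable_coord[H1r H1i H1j H1k].
move=> /quat_integrable_coord[H2r H2i H2j H2k] GE.
have {}GE x := etrans (GE x) (congr1 (fun z => H1 x + H2 x - z) (quat_iMj _ _)).
rewrite quat_iMj; congr Quat => /=.
- apply: (Rintegral_double_eq _ _ _ _ _ Gr H1r H2r H1k H2k) => x.
  by have := congr1 (@qr R) (GE x).
(* The [i] and [j] coordinates of [i q j] carry a minus sign, absorbed by exchanging [H1] and [H2]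
   in the last difference. *)
- rewrite opprB; apply: (Rintegral_double_eq _ _ _ _ _ Gi H1i H2i H2j H1j) => x.
  by have := congr1 (@qi R) (GE x); rewrite /= opprB.
- rewrite opprB; apply: (Rintegral_double_eq _ _ _ _ _ Gj H1j H2j H2i H1i) => x.
  by have := congr1 (@qj R) (GE x); rewrite /= opprB.
- apply: (Rintegral_double_eq _ _ _ _ _ Gk H1k H2k H1r H2r) => x.
  by have := congr1 (@qk R) (GE x).
Qed.

Lemma quat_integral_linear (a b c d : R) G : a * d - b * c != 0 ->
  quat_integrable G ->
  quat_integral (fun x => G (a * x.1 + b * x.2, c * x.1 + d * x.2)) =
  `|a * d - b * c|^-1 *: quat_integral G.
Proof.
move=> D0 /quat_integrable_coord[Gr Gi Gj Gk].
congr Quat.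
- exact: (Rintegral_plane_linear _ _ _ _ _ D0 _ Gr).
- exact: (Rintegral_plane_linear _ _ _ _ _ D0 _ Gi).
- exact: (Rintegral_plane_linear _ _ _ _ _ D0 _ Gj).
- exact: (Rintegral_plane_linear _ _ _ _ _ D0 _ Gk).
Qed.

End QuaternionIntegral.

(** * Explicit formulas for two-by-two matrices *)

Section TwoByTwo.
Variable R : realType.

Lemma det_mx2 (a b c d : R) : \det (mx2 a b c d) = a * d - b * c.
Proof.
rewrite (expand_det_row _ 0) !big_ord_recl big_ord0 /cofactor !det_mx11 !mxE /=.
ring.
Qed.

Lemma invmx_mx2 (a b c d : R) : a * d - b * c != 0 ->
  invmx (mx2 a b c d) = (a * d - b * c)^-1 *: mx2 d (- b) (- c) a.
Proof.
move=> D0; have mA : mx2 a b c d \in unitmx by rewrite unitmxE unitfE det_mx2.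
rewrite -[RHS](mulKmx mA) (_ : mx2 a b c d *m _ = 1%:M) ?mulmx1//.
apply/matrixP => i j; rewrite !mxE !big_ord_recl big_ord0 !mxE.
by case: i => [[|[|//]] ?]; case: j => [[|[|//]] ?] /=; field.
Qed.

Lemma tr_mx2 (a b c d : R) : (mx2 a b c d)^T = mx2 a c b d.
Proof. by apply/matrixP => i j; rewrite !mxE; case: eqP; case: eqP. Qed.

Lemma mx_plane_mx2 (a b c d : R) x :
  mx_plane (mx2 a b c d) x = (a * x.1 + b * x.2, c * x.1 + d * x.2).
Proof. by rewrite /mx_plane !mxE. Qed.

Lemma mx_planeZ (k : R) (M : 'M[R]_2) x :
  mx_plane (k *: M) x = (k * (mx_plane M x).1, k * (mx_plane M x).2).
Proof. by rewrite /mx_plane !mxE /= !mulrDr !mulrA. Qed.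

End TwoByTwo.

Theorem theorem2p6 (R : realType) (f : R * R -> quat R) (a b c d : R)
    (A := mx2 a b c d)
    (Bp := (invmx A)^T)
    (Bm := (\det A)^-1 *: mx2 d c b a) :
  quat_L2 f -> quat_integrable f -> A \in unitmx ->
  [/\ \det Bp = (\det A)^-1,
      \det Bm = (\det A)^-1 &
      forall u : R * R,
        qft (fun x => f (mx_plane A x)) u =
          (`|\det Bp| / 2) *:
            (qft f (mx_plane Bp u) + qft f (mx_plane Bm u)
             - quat_i * (qft f (mx_plane Bp u) - qft f (mx_plane Bm u)) * quat_j)].
Proof.
move=> _ intf Au.
have detA : \det A = a * d - b * c by rewrite /A det_mx2.
have D0 : a * d - b * c != 0 by rewrite -detA -unitfE -unitmxE.
have BpE : Bp = (a * d - b * c)^-1 *: mx2 d (- c) (- b) a.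
  by rewrite /Bp /A invmx_mx2// linearZ /= tr_mx2.
have detBp : \det Bp = (\det A)^-1.
  by rewrite /Bp det_tr det_inv.
split=> //.
  rewrite /Bm detZ detA det_mx2; field; exact: D0.
move=> u.
rewrite detBp detA normfV.
set D := a * d - b * c in D0 *.
(* The phases of the transform at [u], with the old variable expressed as [A^-1] applied to the new
   one. *)
pose G x := sandwich (f x) (- (d / D * u.1) * x.1 + b / D * u.1 * x.2)
                           (c / D * u.2 * x.1 + - (a / D * u.2) * x.2).
have iG : quat_integrable G by exact: quat_integrable_sandwich.
have -> : qft (fun x => f (mx_plane A x)) u = `|D|^-1 *: quat_integral G.
  apply: etrans (quat_integral_linear _ _ _ _ _ G D0 iG).
  apply: (congr1 (@quat_integral R)); apply/funext => x.
  rewrite mx_plane_mx2; apply: (congr2 (sandwich _)).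
    by rewrite /D /=; field.
  by rewrite /D /=; field.
have H := quat_integral_split _ _ _ _ iG
  (quat_integrable_qft _ _ (mx_plane Bp u) intf)
  (quat_integrable_qft _ _ (mx_plane Bm u) intf).
rewrite -[RHS]scalerA; congr (_ *: _).
(* Moving the factor 1/2 across yields the doubled integral of [quat_integral_split]. *)
apply: (canRL (scalerK _)); first by rewrite pnatr_eq0.
rewrite scaler_nat mulr2n; apply: H => x.
(* The coefficients of both coordinates agree in the sum of phases for [Bp] and in their difference
   for [Bm]. *)
by apply: sandwich_split;
  rewrite ?BpE /Bm ?detA mx_planeZ !mx_plane_mx2 /= /D; field.
Qed.
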